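(* Let $I$ be an isolated invariant set for a continuous flow $\varphi^t$ on a semi-locally contractible metric space $X$. If $\varphi^t|_I$ is gradient-like, then $\varphi^t$ has at least $\nu_H(h(I))-1$ rest points in $I$.
   Context: Flow: $\varphi^t$ ($t\in\mathbb{R}$) is a continuous $\mathbb{R}$-action on $X$. For $J\subset\mathbb{R}$, $\varphi^J(x)=\{\varphi^t(x): t\in J\}$. A set $S$ is invariant if $\varphi^t(S)=S$ for all $t\in\mathbb{R}$. A rest point is a point fixed by all $\varphi^t$. A flow is gradient-like if there is a continuous real-valued function strictly decreasing along every nonconstant orbit. A topological space $X$ is semi-locally contractible if for every $x\in X$ and every open $U\subset X$ with $x\in U$ there is a neighborhood $V$ of $x$ with $x\in V\subset U$ and $V$ contractible in $U$ (i.e. the inclusion $V\to U$ is homotopic to a constant map). Isolated invariant set: a subset $I\subset X$ which is the maximal invariant set in some compact neighborhood of itself; such a neighborhood is called an isolating neighborhood for $I$. Quotient and induced semi-flow: for a compact pair $(N,L)$ (i.e. $L\subset N\subset X$ compact), $N/L$ is the pointed space obtained by collapsing $L$ to the point $[L]$ (if $L=\varnothing$, $N/L$ is the disjoint union of $N$ and one point $[L]$). The induced semi-flow $\varphi^t_{\#}:N/L\to N/L$ ($t\ge 0$) is $\varphi^t_{\#}(x)=\varphi^t(x)$ if $\varphi^{[0,t]}(x)\subset N-L$, and $\varphi^t_{\#}(x)=[L]$ otherwise. Index pair for $I$: a compact pair $(N,L)$ in $X$ such that $I\cap L=\varnothing$, $\overline{N-L}$ is an isolating neighborhood for $I$, and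 $\varphi^t_{\#}$ is continuous. Every isolated invariant set has an index pair, and the homotopy type of the pointed space $N/L$ does not depend on the index pair; this homotopy type is the Conley index $h(I)$. HLS category: for a topological space $M$, a subset $A\subset M$ is contractible in $M$ if the inclusion $A\to M$ is homotopic to a constant map. $\nu_H(A)=\nu_H(A,M)$ is the minimum number of open subsets of $M$, each contractible in $M$, needed to cover $A$ ($\infty$ if there is no such finite cover). $\nu_H(h(I))$ means $\nu_H(N/L,N/L)$ for any index pair $(N,L)$ of $I$; this is independent of the choice of $(N,L)$. *)

(* Defs.v *)
From HB Require Import structures.
From mathcomp Require Import all_boot all_order all_algebra.
From mathcomp Require Import all_classical all_reals all_analysis.

Set Implicit Arguments.
Unset Strict Implicit.
Unset Printing Implicit Defensive.

Import Order.TTheory GRing.Theory Num.Theory.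
Import numFieldNormedType.Exports.

Local Open Scope classical_set_scope.
Local Open Scope ring_scope.

(* The underlying set of [N/L] is [N \ L] (the [Some _]) together with the
   base point [[L]] (which is [None]).  The topology is the final one for
   [collapse : N -> N/L].  When [L] is nonempty, [collapse] is onto and this is
   the quotient topology; when [L] is empty, [None] is not in the range of
   [collapse] and this is the disjoint union of [N] and a point.  The latter
   case is why the library's [quotient_topology], which needs a surjection
   from [N], is not used. *)
Definition collapsed (T : topologicalType) (N L : set T) : Type :=
  option (N `\` L).

Definition collapse (T : topologicalType) (N L : set T) (x : N) :
  collapsed N L := insub (set_val x).

Section CollapsedTopology.
Context {T : topologicalType} (N L : set T).

HB.instance Definition _ := Choice.on (collapsed N L).
HB.instance Definition _ := isPointed.Build (collapsed N L) None.

Definition collapsed_open (U : set (collapsed N L)) : Prop :=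
  open (@collapse T N L @^-1` U).

Let collapsed_openT : collapsed_open setT.
Proof. by rewrite /collapsed_open preimage_setT; exact: openT. Qed.

Let collapsed_openI (U V : set (collapsed N L)) :
  collapsed_open U -> collapsed_open V -> collapsed_open (U `&` V).
Proof. by move=> oU oV; exact: openI. Qed.

Let collapsed_open_bigU (I : Type) (f : I -> set (collapsed N L)) :
  (forall i, collapsed_open (f i)) -> collapsed_open (\bigcup_i f i).
Proof. by move=> of_; apply: bigcup_open => i _; exact: of_. Qed.

HB.instance Definition _ := isOpenTopological.Build (collapsed N L)
  collapsed_openT collapsed_openI collapsed_open_bigU.

End CollapsedTopology.

Section Homotopy.
Context (R : realType) (M : topologicalType).

(* The inclusion [A -> B] is homotopic, through maps into [B], to a constant. *)
Definition contractible_in (A B : set M) : Prop :=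
  exists (H : R * M -> M) (c : M),
    [/\ {within `[0, 1] `*` A, continuous H},
        forall t a, t \in `[0, 1] -> A a -> B (H (t, a)),
        forall a, A a -> H (0, a) = a,
        forall a, A a -> H (1, a) = c
      & B c].

Definition semi_locally_contractible : Prop :=
  forall (x : M) (U : set M), open U -> U x ->
    exists V : set M, [/\ nbhs x V, V `<=` U & contractible_in V U].

(* [ereal_inf set0 = +oo] covers the case where there is no finite cover. *)
Definition nuH (A : set M) : \bar R :=
  ereal_inf [set n%:R%:E | n in [set n : nat |
    exists U : 'I_n -> set M,
      (forall i, open (U i) /\ contractible_in (U i) setT) /\
      A `<=` \bigcup_i U i]].

End Homotopy.

Section Flows.
Context (R : realType) (X : topologicalType).
Implicit Types (phi : R -> X -> X) (I N L S : set X).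

Definition is_flow phi : Prop :=
  [/\ continuous (fun p : R * X => phi p.1 p.2),
      forall x, phi 0 x = x
    & forall s t x, phi (s + t) x = phi s (phi t x)].

Definition invariant_set phi S : Prop := forall t, phi t @` S = S.

Definition rest_points phi : set X := [set x | forall t, phi t x = x].

Definition maximal_invariant_in phi I N : Prop :=
  [/\ invariant_set phi I, I `<=` N
    & forall S, invariant_set phi S -> S `<=` N -> S `<=` I].

Definition isolating_neighborhood phi N I : Prop :=
  [/\ compact N, I `<=` interior N & maximal_invariant_in phi I N].

Definition isolated_invariant_set phi I : Prop :=
  exists N, isolating_neighborhood phi N I.

Definition gradient_like_on phi I : Prop :=
  exists2 g : X -> R, {within I, continuous g} &
    forall x, I x -> ~ rest_points phi x ->
      forall s t, s < t -> g (phi t x) < g (phi s x).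

(* Meaningful for [0 <= t]; the condition at [s = t] makes the [insub] a
   [Some]. *)
Definition induced_semiflow phi N L (t : R) (y : collapsed N L) :
    collapsed N L :=
  if y is Some x then
    if `[< phi^~ (set_val x) @` `[0, t] `<=` N `\` L >]
    then insub (phi t (set_val x)) else None
  else None.

(* Continuity of the induced semi-flow is joint continuity in time and space.
   Continuity of each time-[t] map alone would not do: for the translation flow
   on the line, [N := [set 0]], [L := set0] and [I := set0] would otherwise be
   an index pair, with [N/L] the discrete two-point space. *)
Definition index_pair phi N L I : Prop :=
  [/\ compact N, compact L, L `<=` N, I `&` L = set0
    & isolating_neighborhood phi (closure (N `\` L)) I /\
      {within [set p : R * collapsed N L | 0 <= p.1],
        continuous (fun p : R * collapsed N L =>
          induced_semiflow phi p.1 p.2)}].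

End Flows.

(* Main.v *)
Require Import Defs.
From HB Require Import structures.
From mathcomp Require Import all_boot all_order all_algebra.
From mathcomp Require Import all_classical all_reals all_analysis.
From mathcomp Require Import ring lra.

Set Implicit Arguments.
Unset Strict Implicit.
Unset Printing Implicit Defensive.

Import Order.TTheory GRing.Theory Num.Theory.
Import numFieldNormedType.Exports.

Local Open Scope classical_set_scope.
Local Open Scope ring_scope.
(** The induced semiflow [psi] on [N/L] deforms every point either to the base
    point or towards a rest point of [I], and the base point absorbs a whole
    neighbourhood in bounded time.  List the rest points by increasing value
    of the Lyapunov function [g], and let the basin of an initial segment be
    the set of points that reach the base point or accumulate on a rest point
    of the segment.  By induction these basins are open: an orbit that comes
    close to a rest point [r] and leaves again leaves along an orbit of [I]
    emanating from [r], hence enters the basin of the points below [r].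
    Therefore the part of a compact set [S] that lies in the basin of
    [r_1, .., r_k] but not in that of [r_1, .., r_(k-1)] is pushed by [psi T],
    for [T] large, into a contractible neighbourhood of [r_k].  Pulling that
    neighbourhood back gives an open set contractible in [N/L], and what
    remains of [S] is compact and in the smaller basin.  The base point
    accounts for the one additional set. *)

(** * Hitting times on the real line *)

Lemma first_hit (R : realType) (A : set R) (T : R) :
  closed A -> 0 <= T -> A T ->
  exists s : R, [/\ 0 <= s, s <= T, A s & forall u : R, 0 <= u -> u < s -> ~ A u].
Proof.
move=> clA T0 AT; pose S := A `&` [set t | 0 <= t].
have ST : S T by [].
have lbS : has_lbound S by exists 0 => t [].
have hiS : has_inf S by split => //; exists T.
have clS : closed S by apply: closedI => //; exact: closed_ge.
(* The hitting time is the infimum of [S], which belongs to [S] because [S] is closed. *)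
have [As s0] : S (inf S).
  suff : closure S (inf S) by rewrite -((closure_id S).1 clS).
  move=> B /nbhs_ballP[e /= e0 Be].
  have [t St lt_t] := inf_adherent e0 hiS.
  exists t; split => //; apply: Be.
  have le_t := ge_inf lbS St.
  by rewrite /ball /= ler0_norm ?subr_le0// opprB ltrBlDl.
exists (inf S); split => //; first exact: ge_inf.
move=> u u0 us Au; have := ge_inf lbS (conj Au u0 : S u).
by rewrite leNgt us.
Qed.

(** * Flows and their omega-limit sets *)

Section FlowOmega.
Context (R : realType) (X : topologicalType) (phi : R -> X -> X).
Hypothesis phi_flow : is_flow phi.

Lemma flow0 x : phi 0 x = x. Proof. by case: phi_flow. Qed.

Lemma flowD s t x : phi (s + t) x = phi s (phi t x).
Proof. by case: phi_flow. Qed.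

Lemma flow_cvg (T : Type) (F : set_system T) (FF : Filter F)
    (f : T -> R) (h : T -> X) a b :
  f @ F --> a -> h @ F --> b -> phi (f z) (h z) @[z --> F] --> phi a b.
Proof.
move=> fa hb; case: phi_flow => cphi _ _.
exact: continuous2_cvg (cphi (a, b)) fa hb.
Qed.

Lemma flow_continuous t : continuous (phi t).
Proof. by move=> x; apply: flow_cvg; [exact: cvg_cst|exact: cvg_id]. Qed.

Lemma orbit_continuous x : continuous (phi^~ x).
Proof. by move=> t; apply: flow_cvg; [exact: cvg_id|exact: cvg_cst]. Qed.

(** Lets backward limit points be treated as omega-limit points of the reversed flow. *)
Lemma flow_reverse : is_flow (fun t => phi (- t)).
Proof.
split=> [p|x|s t x]; last by rewrite opprD flowD.
- by apply: flow_cvg; [apply: cvgN; exact: cvg_fst|exact: cvg_snd].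
- by rewrite oppr0 flow0.
Qed.

Lemma invariant_setP (S : set X) :
  invariant_set phi S <-> forall t x, S x -> S (phi t x).
Proof.
split=> [invS t x Sx|invS t]; first by rewrite -(invS t); exists x.
apply/seteqP; split=> [_ [x Sx <-]|x Sx]; first exact: invS.
by exists (phi (- t) x); [exact: invS|rewrite -flowD subrr flow0].
Qed.

(** The cluster points of the forward orbit as time tends to [+oo], expressed by arbitrarily late
    visits to each neighbourhood. *)
Definition omega (x : X) : set X :=
  [set p | forall A T, nbhs p A -> exists2 t : R, T <= t & A (phi t x)].

Lemma omega_nonempty (K : set X) x : compact K ->
  (forall t : R, 0 <= t -> K (phi t x)) -> exists2 p, K p & omega x p.
Proof.
move=> cK Kx.
have [|p [Kp clp]] := cK (phi^~ x @ +oo).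
  by exists 0; split => // t /ltW; exact: Kx.
exists p => // A T Ap.
have [|_ [[t Tt <-] At]] := clp (phi^~ x @` [set t | T <= t]) A _ Ap.
  by exists T; split; [exact: num_real|move=> t Tt; exists t => //; exact: ltW].
by exists t.
Qed.

Lemma omega_sub (C : set X) x T :
  closed C -> (forall t : R, T <= t -> C (phi t x)) -> omega x `<=` C.
Proof.
move=> clC Cx p px; rewrite (closure_id C).1// => B /(px _ T)[t Tt Bt].
by exists (phi t x); split => //; exact: Cx.
Qed.

Lemma omega_flow s x p : omega x p -> omega x (phi s p).
Proof.
move=> px A T /(@flow_continuous s _ _) Ap.
have [t st At] := px _ (T - s) Ap.
by exists (s + t); [rewrite -lerBlDl|rewrite flowD].
Qed.

Lemma omega_shift s x : omega (phi s x) = omega x.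
Proof.
apply/seteqP; split=> p px A T Ap.
  have [t Tt At] := px A (T - s) Ap.
  by exists (t + s); [rewrite -lerBlDr|rewrite flowD].
have [t Tt At] := px A (T + s) Ap.
by exists (t - s); [rewrite lerBrDr|rewrite -flowD subrK].
Qed.

(** By continuity of [phi t], an orbit that comes close enough to [z] follows the orbit of [z] up to
    time [t], hence into any given neighbourhood of a limit point of [z]. *)
Lemma omega_trans x z : omega x z -> omega z `<=` omega x.
Proof.
move=> xz p zp A T; rewrite nbhsE => -[B [oB Bp] BA].
have [t _ Bt] := zp B 0 (open_nbhs_nbhs (conj oB Bp)).
have [|u Tu Bu] := xz (phi t @^-1` B) (T - t).
  by apply: (@flow_continuous t); exact: open_nbhs_nbhs.
by exists (t + u); [rewrite -lerBlDl|rewrite flowD; exact: BA].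
Qed.

(** * The Lyapunov function along orbits in [I] *)

Section Lyapunov.
Context (I : set X) (g : X -> R).
Hypothesis I_invariant : invariant_set phi I.
Hypothesis g_continuous : {within I, continuous g}.
Hypothesis g_decreasing : forall x, I x -> ~ rest_points phi x ->
  forall s t : R, s < t -> g (phi t x) < g (phi s x).

Lemma lyapunov_le z (s t : R) : I z -> s <= t -> g (phi t z) <= g (phi s z).
Proof.
move=> Iz; rewrite le_eqVlt => /predU1P[->//|st].
have [rz|rz] := pselect (rest_points phi z); first by rewrite !rz.
exact/ltW/g_decreasing.
Qed.

(** [g] is continuous only within [I], so a neighbourhood statement about it constrains only points
    of [I]. *)
Let g_within p (A : set R) : I p -> nbhs (g p) A ->
  nbhs p [set x | I x -> A (g x)].
Proof.
move=> Ip gA; have gp := (subspace_continuousP I g).1 g_continuous p Ip.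
exact: gp _ gA.
Qed.

(** Were [g p] larger, a visit close to [p] after time [t] would raise [g] above its value at time
    [t], against monotonicity. *)
Lemma lyapunov_omega_le z p t : I z -> I p -> omega z p -> g p <= g (phi t z).
Proof.
move=> Iz Ip zp; rewrite leNgt; apply/negP => gtp.
have [|u tu] := zp _ t (g_within Ip (A := [set a | g (phi t z) < a]) _).
  exact: lt_nbhsr.
move/(_ ((invariant_setP I).1 I_invariant _ _ Iz)) => /=.
by rewrite ltNge lyapunov_le.
Qed.

Lemma lyapunov_omega_lt z p :
  I z -> ~ rest_points phi z -> I p -> omega z p -> g p < g z.
Proof.
move=> Iz rz Ip zp; apply: (le_lt_trans (lyapunov_omega_le 1 Iz Ip zp)).
by rewrite -[in ltRHS](flow0 z); exact: g_decreasing.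
Qed.

(** LaSalle's principle: if [p] moved, [phi 1 p] would be a limit point of lower value, so the orbit
    of [z] would reach values below [g p], which bounds [g] from below along it. *)
Lemma lyapunov_omega_rest z :
  I z -> omega z `<=` I -> omega z `<=` rest_points phi.
Proof.
move=> Iz zI p zp; apply: contrapT => rp; have Ip := zI _ zp.
have gp : g (phi 1 p) < g p.
  by rewrite -[in ltRHS](flow0 p); exact: g_decreasing.
have z1p := @omega_flow 1 _ _ zp.
have [|u _] := z1p _ 0 (g_within (zI _ z1p) (A := [set a | a < g p]) _).
  exact: lt_nbhsl.
move/(_ ((invariant_setP I).1 I_invariant _ _ Iz)) => /=.
by rewrite ltNge lyapunov_omega_le.
Qed.

End Lyapunov.
End FlowOmega.

(** * The topology of [N/L] *)

Section CollapsedSpace.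
Context (T : topologicalType) (N L : set T).

(** Extends [collapse] to the whole space, so that no membership proof is carried along; continuity
    can be expected only within [N]. *)
Definition proj (x : T) : collapsed N L := insub x.

(** Inverse to [proj] away from the base point; [x0] is a dummy value at the base point. *)
Definition lift (x0 : T) (y : collapsed N L) : T :=
  if y is Some x then set_val x else x0.

Lemma proj_None x : ~ (N `\` L) x -> proj x = None.
Proof. by move=> NLx; apply: insubN; apply/negP => /set_mem. Qed.

Lemma projK x0 x : (N `\` L) x -> lift x0 (proj x) = x.
Proof. by move=> /mem_set NLx; rewrite /proj insubT. Qed.

Lemma proj_neq_None x : (N `\` L) x -> proj x <> None.
Proof. by move=> /mem_set NLx; rewrite /proj insubT. Qed.

Lemma proj_inj x x' : (N `\` L) x -> proj x = proj x' -> x = x'.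
Proof.
move=> NLx xx'; have [NLx'|/proj_None x'N] := pselect ((N `\` L) x').
  by rewrite -(projK x NLx') -xx' projK.
by have := proj_neq_None NLx; rewrite xx'.
Qed.

Lemma collapsedP y : y = None \/ exists2 x, (N `\` L) x & y = proj x.
Proof.
case: y => [[x xNL]|]; last by left.
right; exists x; first exact: set_mem.
by rewrite /proj insubT.
Qed.

Lemma open_collapsedP (W : set (collapsed N L)) :
  open W <-> exists2 G, open G & forall x, N x -> W (proj x) <-> G x.
Proof.
split=> [|[G oG GW]].
  rewrite {1}/open/= => -[G oG GW]; exists G => // x Nx.
  have := congr1 (fun P : set N => P (SigSub (mem_set Nx))) GW.
  by rewrite /preimage /collapse /= => <-.
have : open (set_val @^-1` G : set N) by exists G.
congr open; apply/funext => x; apply/propext => /=; rewrite -GW //.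
exact: set_valP.
Qed.

Lemma proj_continuous : {within N, continuous proj}.
Proof.
apply/subspace_continuousP => x Nx A; rewrite nbhsE => -[W [oW Wx] WA].
have /open_collapsedP[G oG GW] := oW.
have : nbhs x G by apply: open_nbhs_nbhs; split => //; apply/GW.
by apply: filterS => z Gz Nz; apply/WA/GW.
Qed.

Lemma proj_interior_continuous x : nbhs x N -> {for x, continuous proj}.
Proof.
move=> Nx A /((subspace_continuousP _ _).1 proj_continuous _ (nbhs_singleton Nx)).
by move=> NA; apply: filterS2 Nx NA => z Nz; exact.
Qed.

Lemma compact_collapsed : compact N -> compact [set: collapsed N L].
Proof.
move=> cN; have cpN := continuous_compact proj_continuous cN.
have -> : [set: collapsed N L] = (proj @` N) `|` [set None].
  apply/seteqP; split=> // y _; case: (collapsedP y) => [->|[x [Nx _] ->]].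
    by right.
  by left; exists x.
by apply: compactU => //; exact: compact_set1.
Qed.

Lemma open_proj (V : set T) : open V -> V `<=` N `\` L -> open (proj @` V).
Proof.
move=> oV VNL; apply/open_collapsedP; exists V => // x Nx; split=> [[z Vz zx]|Vx].
  by rewrite -(proj_inj (VNL _ Vz) zx).
by exists x.
Qed.

(** As [L] is closed, the points of [G] outside [L] have an open image in [N/L] that misses the base
    point and hence the dummy value. *)
Lemma lift_continuous x0 x : closed L -> (N `\` L) x ->
  {for proj x, continuous (lift x0)}.
Proof.
move=> clL NLx A; rewrite projK// nbhsE => -[G [oG Gx] GA].
apply: (@filterS _ _ _ (proj @` ((N `\` L) `&` G))).
  move=> _ [z [NLz Gz] <-] /=; have -> := projK x0 NLz; exact: GA.
apply: open_nbhs_nbhs; split; last by exists x.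
apply/open_collapsedP; exists (~` L `&` G).
  by apply: openI => //; exact: closed_openC.
move=> z Nz; split=> [[u [NLu Gu] uz]|[Lz Gz]]; last by exists z.
by rewrite -(proj_inj NLu uz); split => //; case: NLu.
Qed.

Lemma open_setC1_proj x : closed [set x] -> (N `\` L) x -> open (~` [set proj x]).
Proof.
move=> clx NLx; apply/open_collapsedP; exists (~` [set x]).
  exact: closed_openC.
move=> z Nz; split=> zx /= zx'; apply: zx => /=; first by rewrite zx'.
exact/esym/(proj_inj NLx).
Qed.

End CollapsedSpace.

(** * The semigroup law and continuity of the induced semiflow *)

Section InducedSemiflow.
Context (R : realType) (X : topologicalType) (phi : R -> X -> X).
Context (N L : set X).
Hypothesis phi_flow : is_flow phi.

Local Notation proj := (@proj X N L).
Local Notation psi := (@induced_semiflow R X phi N L).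

Lemma semiflow_proj (t : R) x : 0 <= t ->
  (forall s : R, 0 <= s -> s <= t -> (N `\` L) (phi s x)) ->
  psi t (proj x) = proj (phi t x).
Proof.
move=> t0 xt; have NLx : (N `\` L) x by rewrite -(flow0 phi_flow x); exact: xt.
rewrite /proj insubT/=; first exact: mem_set.
move=> H; rewrite ifT//; apply/asboolP => _ [s /= + <-].
by rewrite in_itv/= => /andP[]; exact: xt.
Qed.

Lemma semiflow_exit (s t : R) x : 0 <= s -> s <= t -> ~ (N `\` L) (phi s x) ->
  psi t (proj x) = None.
Proof.
move=> s0 st NLs; have [NLx|/proj_None->//] := pselect ((N `\` L) x).
rewrite /proj insubT/=; first exact: mem_set.
move=> H; rewrite ifF//; apply/asboolP => xt; apply/NLs/xt; exists s => //=.
by rewrite in_itv/= s0.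
Qed.

Lemma semiflow0 y : psi 0 y = y.
Proof.
case: (collapsedP y) => [->//|[x NLx ->]].
rewrite semiflow_proj// ?flow0// => s s0 s0'.
have -> : s = 0 by apply/le_anti/andP.
by rewrite flow0.
Qed.

Lemma semiflowD (s t : R) y : 0 <= s -> 0 <= t -> psi (s + t) y = psi s (psi t y).
Proof.
move=> s0 t0; case: (collapsedP y) => [->//|[x NLx ->]].
(* An orbit that leaves [N] minus [L] during the first [t] units of time, or during the next [s], is
   at the base point on both sides. *)
have [xt|/existsNP[u /not_implyP[u0 /not_implyP[ut NLu]]]] :=
    pselect (forall u : R, 0 <= u -> u <= t -> (N `\` L) (phi u x)); last first.
  rewrite (semiflow_exit u0 ut NLu) (semiflow_exit u0 _ NLu)//.
  by rewrite (le_trans ut)// lerDr.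
rewrite (semiflow_proj t0)//.
have [xs|/existsNP[u /not_implyP[u0 /not_implyP[us NLu]]]] :=
    pselect (forall u : R, 0 <= u -> u <= s -> (N `\` L) (phi u (phi t x))); last first.
  rewrite (semiflow_exit u0 us NLu) (@semiflow_exit (u + t))//.
  - by rewrite addr_ge0.
  - by rewrite lerD2r.
  - by rewrite flowD.
rewrite !semiflow_proj// ?flowD// ?addr_ge0// => u u0 ust.
have [ut|tu] := leP u t; first exact: xt.
rewrite -(subrK t u) flowD//; apply: xs; first by rewrite subr_ge0 ltW.
by rewrite lerBlDr.
Qed.

Hypothesis psi_continuous : {within [set p : R * collapsed N L | 0 <= p.1],
  continuous (fun p : R * collapsed N L => psi p.1 p.2)}.

(** [psi] is known to be continuous only for nonnegative times, hence the sign conditions on [a] and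
    [f]. *)
Lemma semiflow_cvg (U : Type) (F : set_system U) (FF : Filter F)
    (f : U -> R) (h : U -> collapsed N L) (a : R) (b : collapsed N L) :
  0 <= a -> (\forall u \near F, 0 <= f u) ->
  f @ F --> a -> h @ F --> b -> psi (f u) (h u) @[u --> F] --> psi a b.
Proof.
move=> a0 f0 fa hb A pA.
have /(_ _ pA) H0 := (subspace_continuousP _ _).1 psi_continuous (a, b) a0.
have H := cvg_pair fa hb H0.
suff : F [set u | A (psi (f u) (h u))] by [].
apply: filterS2 f0 (H _ _ _) => u fu0 /=; exact.
Qed.

Lemma semiflow_continuous (t : R) : 0 <= t -> continuous (psi t).
Proof.
move=> t0 y; apply: (@semiflow_cvg _ (nbhs y) _ (fun=> t) id) => //; first exact: nearW.
exact: cvg_cst.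
Qed.

End InducedSemiflow.

(** * Limits within sets, and sets contractible in [N/L] *)

Lemma cvg_comp_within (U : Type) (T S : topologicalType) (F : set_system U)
    (FF : Filter F) (u : U -> T) (f : T -> S) (E : set T) (q : T) :
  u @ F --> q -> (\forall z \near F, E (u z)) ->
  f @ within E (nbhs q) --> f q -> f (u z) @[z --> F] --> f q.
Proof.
move=> uq Eu fq A fA; have H := uq _ (fq _ fA).
suff : F [set z | A (f (u z))] by [].
by apply: filterS2 Eu H => z Ez /=; exact.
Qed.

(** Pasting lemma at a point: a closed piece that misses [p] also misses a neighbourhood of [p], so
    only pieces containing [p] need a limit. *)
Lemma cvg_within_closed_cover (T S : topologicalType) (D C1 C2 : set T)
    (f : T -> S) (p : T) :
  closed C1 -> closed C2 -> D `<=` C1 `|` C2 ->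
  (C1 p -> f @ within (D `&` C1) (nbhs p) --> f p) ->
  (C2 p -> f @ within (D `&` C2) (nbhs p) --> f p) ->
  f @ within D (nbhs p) --> f p.
Proof.
move=> c1 c2 DC f1 f2 A fA.
have near_piece C : closed C ->
    (C p -> f @ within (D `&` C) (nbhs p) --> f p) ->
    nbhs p [set x | D x -> C x -> A (f x)].
  move=> cC fC; have [Cp|Cp] := pselect (C p).
    have : nbhs p [set x | (D `&` C) x -> A (f x)] := fC Cp _ fA.
    by apply: filterS => x DCA Dx Cx; exact: DCA.
  have : nbhs p (~` C) by apply: open_nbhs_nbhs; split => //; exact: closed_openC.
  by apply: filterS => x nCx _ Cx; have := nCx Cx.
suff : nbhs p [set x | D x -> A (f x)] by [].
apply: filterS2 (near_piece _ c1 f1) (near_piece _ c2 f2) => x A1 A2 Dx.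
by have [C1x|C2x] := DC _ Dx; [exact: A1|exact: A2].
Qed.

Section ContractibleCollapsed.
Context (R : realType) (X : topologicalType) (phi : R -> X -> X).
Context (N L : set X).
Hypothesis phi_flow : is_flow phi.
Hypothesis psi_continuous : {within [set p : R * collapsed N L | 0 <= p.1],
  continuous (fun p : R * collapsed N L => induced_semiflow phi p.1 p.2)}.

Local Notation proj := (@proj X N L).
Local Notation psi := (@induced_semiflow R X phi N L).

Lemma contractible_in_sub (M : topologicalType) (A A' B : set M) :
  A' `<=` A -> contractible_in R A B -> contractible_in R A' B.
Proof.
move=> AA [H [c [cH HB H0 H1 Bc]]]; exists H, c; split => //.
- apply: continuous_subspaceW cH.
  by move=> [t x] [/= t01 /AA]; split.
- by move=> t x t01 /AA; exact: HB.
- by move=> x /AA; exact: H0.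
- by move=> x /AA; exact: H1.
Qed.

(** The homotopy first runs the semiflow up to time [T], which carries [A] into [B], and then
    applies a contraction of [B]. *)
Lemma contractible_in_pullback (T : R) (A B : set (collapsed N L)) :
  0 <= T -> (forall y, A y -> B (psi T y)) ->
  contractible_in R B setT -> contractible_in R A setT.
Proof.
move=> T0 AB [H [c [cH _ H0 H1 _]]].
pose K (p : R * collapsed N L) :=
  if p.1 <= 2^-1 then psi (2 * T * p.1) p.2 else H (2 * p.1 - 1, psi T p.2).
(* At parameter 1/2 both formulas give [psi T p.2], because [H] starts as the identity on [B]. *)
have KE p : 2^-1 <= p.1 -> A p.2 -> K p = H (2 * p.1 - 1, psi T p.2).
  move=> p2 Ap; rewrite /K; case: ifPn => // p2'.
  have -> : p.1 = 2^-1 by apply/le_anti/andP.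
  have -> : 2 * T * 2^-1 = T by field.
  by rewrite divff// subrr H0//; exact: AB.
have in01_ge0 (t : R) : `[0, 1]%classic t -> 0 <= t.
  by rewrite /= in_itv/= => /andP[].
exists K, c; split => //.
- apply/subspace_continuousP => p [p01 Ap].
  apply: (@cvg_within_closed_cover (R * collapsed N L)%type (collapsed N L)
    (`[0, 1] `*` A) [set q | q.1 <= 2^-1] [set q | 2^-1 <= q.1] K p).
  + by apply: closed_comp (@closed_le _ _) => q _; exact: cvg_fst.
  + by apply: closed_comp (@closed_ge _ _) => q _; exact: cvg_fst.
  + by move=> q _ /=; have [?|/ltW] := leP q.1 2^-1; [left|right].
  + move=> p2.
    have Kp : K p = psi (2 * T * p.1) p.2 by rewrite /K p2.
    rewrite Kp; apply: cvg_trans.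
      apply: (near_eq_cvg (g := K)
        (f := fun q : R * collapsed N L => psi (2 * T * q.1) q.2)).
      by apply: filterS (near_withinT _ _) => q [_ /= q2]; rewrite /K q2.
    apply: semiflow_cvg => //.
    * by rewrite mulr_ge0 ?mulr_ge0//; exact: in01_ge0.
    * apply: filterS (near_withinT _ _) => q [[/= q01 _] _].
      by rewrite mulr_ge0 ?mulr_ge0//; exact: in01_ge0.
    * by apply: cvg_within_filter; apply: cvgMl_tmp; exact: cvg_fst.
    * by apply: cvg_within_filter; exact: cvg_snd.
  + move=> p2; rewrite KE//.
    apply: cvg_trans.
      apply: (near_eq_cvg (g := K)
        (f := fun q : R * collapsed N L => H (2 * q.1 - 1, psi T q.2))).
      by apply: filterS (near_withinT _ _) => q [[_ Aq] /= q2]; rewrite KE.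
    apply: (@cvg_comp_within _ (R * collapsed N L)%type (collapsed N L) _ _
      (fun q : R * collapsed N L => (2 * q.1 - 1, psi T q.2)) H (`[0, 1] `*` B) (2 * p.1 - 1, psi T p.2)).
    * apply: cvg_within_filter.
      have c1 : 2 * q.1 - 1 @[q --> nbhs p] --> 2 * p.1 - 1.
        by apply: cvgB; [apply: cvgMl_tmp; exact: cvg_fst|exact: cvg_cst].
      have c2 : psi T q.2 @[q --> nbhs p] --> psi T p.2.
        apply: (@cvg_comp _ _ _ snd (psi T) (nbhs p) (nbhs p.2)).
          exact: cvg_snd.
        exact: (semiflow_continuous psi_continuous T0).
      exact: cvg_pair c1 c2.
    * apply: filterS (near_withinT _ _) => q [[/= q01 Aq] /= q2].
      split; last exact: AB.
      by move: q01; rewrite /= !in_itv/= => /andP[_ q1]; lra.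
    * apply: (subspace_continuousP _ _).1 cH _ _; split; last exact: AB.
      by move: p01 p2; rewrite /= !in_itv/= => /andP[_ q1] p2; lra.
- by move=> a Aa; rewrite /K/= invr_ge0 ler0n mulr0 semiflow0.
- move=> a Aa; rewrite KE//=; last by rewrite invf_le1// ler1n.
  by rewrite mulr1 [2 - 1](_ : _ = 1) ?H1//; [exact: AB|ring].
Qed.

Lemma contractible_in_set1 (M : topologicalType) (c : M) :
  contractible_in R [set c] setT.
Proof.
exists (fun=> c), c; split => //.
by apply: continuous_subspaceT; exact: cst_continuous.
Qed.

(** The contraction of [V] is transported by [lift] and [proj]. It runs inside the open set [D], so
    [proj] is continuous along it. *)
Lemma contractible_in_proj (V D : set X) : closed L ->
  open V -> V `<=` D -> open D -> D `<=` N `\` L ->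
  contractible_in R V D -> contractible_in R (proj @` V) setT.
Proof.
move=> clL oV VD oD DNL [H [c [cH HD H0 H1 Dc]]].
have liftV y : (proj @` V) y -> exists2 x, V x & y = proj x.
  by move=> [x Vx <-]; exists x.
have projVK x : V x -> lift c (proj x) = x.
  by move=> Vx; apply: projK; exact/DNL/VD.
exists (fun p => proj (H (p.1, lift c p.2))), (proj c); split => //.
- apply/subspace_continuousP => -[t y] [/= t01 /liftV[x Vx ->]].
  have cproj : {for H (t, x), continuous proj}.
    apply: proj_interior_continuous.
    apply: (@filterS _ _ _ D) => [z /DNL[]//|]; apply: open_nbhs_nbhs; split => //.
    by apply: HD => //; exact/mem_set.
  rewrite /from_subspace /= projVK//.
  apply: (@cvg_comp _ _ _ (fun p : R * collapsed N L => H (p.1, lift c p.2)) proj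
    _ (nbhs (H (t, x)))) => //.
  apply: (@cvg_comp_within _ (R * X)%type X _ _
    (fun p : R * collapsed N L => (p.1, lift c p.2)) H (`[0, 1] `*` V) (t, x)).
  + apply: cvg_within_filter.
    have c1 : q.1 @[q --> nbhs (t, proj x)] --> t by exact: cvg_fst.
    have c2 : lift c q.2 @[q --> nbhs (t, proj x)] --> lift c (proj x).
      apply: (@cvg_comp _ _ _ snd (lift c) (nbhs (t, proj x)) (nbhs (proj x))).
        exact: cvg_snd.
      by apply: lift_continuous => //; exact/DNL/VD.
    by rewrite projVK// in c2; exact: cvg_pair c1 c2.
  + apply: filterS (near_withinT _ _) => -[t' y'] /= [t'01 /liftV[x' Vx' ->]].
    by rewrite projVK.
  + exact: (subspace_continuousP _ _).1 cH (t, x) _.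
- by move=> _ [x Vx <-]; rewrite /= projVK// H0.
- by move=> _ [x Vx <-]; rewrite /= projVK// H1.
Qed.

End ContractibleCollapsed.

(** * Isolating neighbourhoods and rest points in limit sets *)

Section IsolatingNeighborhood.
Context (R : realType) (X : topologicalType).
Implicit Types (phi : R -> X -> X) (K I : set X).

Lemma isolating_neighborhood_reverse phi K I : is_flow phi ->
  isolating_neighborhood phi K I ->
  isolating_neighborhood (fun t => phi (- t)) K I.
Proof.
move=> phi_flow [cK IK [invI IK' Imax]]; split => //; split => //.
move=> S invS; apply: Imax => t.
by have := invS (- t); rewrite opprK.
Qed.

Context (phi : R -> X -> X) (K I : set X).
Hypothesis phi_flow : is_flow phi.
Hypothesis K_isolating : isolating_neighborhood phi K I.
Hypothesis K_closed : closed K.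

(** The full orbit is an invariant subset of [K], so maximality of [I] applies. *)
Lemma orbit_in_invariant x : (forall t, K (phi t x)) -> I x.
Proof.
move=> xK; case: K_isolating => _ _ [_ _ Imax].
apply: (Imax [set phi t x | t in setT]).
- apply/(invariant_setP phi_flow) => t _ [s _ <-].
  by exists (t + s) => //; rewrite flowD.
- by move=> _ [t _ <-].
- by exists 0 => //; rewrite flow0.
Qed.

Lemma omega_sub_invariant x : (forall t : R, 0 <= t -> K (phi t x)) ->
  omega phi x `<=` I.
Proof.
move=> xK z xz; apply: orbit_in_invariant => t.
exact: (omega_sub K_closed xK (omega_flow phi_flow xz)).
Qed.

(** [g] controls only orbits in [I], and [x] may lie outside. A limit point [z] of [x] is taken
    first, which lies in [I]; limit points of [z] are rest points and again limit points of [x]. *)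
Lemma omega_rest_point (g : X -> R) x : {within I, continuous g} ->
  (forall z, I z -> ~ rest_points phi z ->
    forall s t : R, s < t -> g (phi t z) < g (phi s z)) ->
  (forall t : R, 0 <= t -> K (phi t x)) ->
  exists r, [/\ I r, rest_points phi r & omega phi x r].
Proof.
move=> g_cont g_decr xK; case: (K_isolating) => cK IK [invI _ _].
have [z _ xz] := omega_nonempty cK xK.
have Iz := omega_sub_invariant xK xz.
have zK (t : R) : 0 <= t -> K (phi t z).
  move=> _; apply: interior_subset; apply: IK.
  exact: ((invariant_setP phi_flow I).1 invI).
have [p _ zp] := omega_nonempty cK zK.
exists p; split; first exact: omega_sub_invariant zp.
- exact: (lyapunov_omega_rest phi_flow invI g_cont g_decr Iz (omega_sub_invariant zK) zp).
- exact: (omega_trans phi_flow xz zp).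
Qed.

End IsolatingNeighborhood.

(** * Index pairs: the exit set, the base point and basins *)

Section IndexPair.
Context (R : realType) (X : topologicalType) (phi : R -> X -> X).
Context (N L I : set X).
Hypothesis X_hausdorff : hausdorff_space X.
Hypothesis phi_flow : is_flow phi.
Hypothesis NL_index : index_pair phi N L I.

Local Notation proj := (@proj X N L).
Local Notation psi := (@induced_semiflow R X phi N L).
Local Notation K := (closure (N `\` L)).

Let cN : compact N. Proof. by case: NL_index. Qed.
Let cL : compact L. Proof. by case: NL_index. Qed.
Let clN : closed N. Proof. exact: compact_closed. Qed.
Let clL : closed L. Proof. exact: compact_closed. Qed.
Let K_isolating : isolating_neighborhood phi K I.
Proof. by case: NL_index => _ _ _ _ []. Qed.
Let cK : compact K. Proof. by case: K_isolating. Qed.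
Let clK : closed K. Proof. exact: closed_closure. Qed.

Let KN : K `<=` N.
Proof.
by rewrite [X in _ `<=` X](closure_id N).1//; apply: closure_subset => x [].
Qed.

Let psi_continuous : {within [set p : R * collapsed N L | 0 <= p.1],
  continuous (fun p : R * collapsed N L => psi p.1 p.2)}.
Proof. by case: NL_index => _ _ _ _ []. Qed.

Lemma index_pair_invariant : invariant_set phi I.
Proof. by case: K_isolating => _ _ []. Qed.

Let I_notin_L x : I x -> ~ L x.
Proof. by move=> Ix Lx; case: NL_index => _ _ _ /seteqP[IL _] _; exact: (IL x). Qed.

(** An open neighbourhood of [I] that misses [L]; neighbourhoods of rest points are chosen inside it
    so that [proj] transports them to [N/L]. *)
Definition index_interior : set X := interior K `\` L.

Local Notation D := index_interior.

Lemma open_index_interior : open D.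
Proof.
by apply: openI; [exact: open_interior|exact: closed_openC].
Qed.

Lemma index_interior_sub : D `<=` N `\` L.
Proof. by move=> x [/interior_subset/KN]. Qed.

Lemma invariant_sub_index_interior : I `<=` D.
Proof.
move=> x Ix; split; last exact: I_notin_L.
by case: K_isolating => _ IK _; exact: IK.
Qed.

(* A point of [L] whose forward orbit stays in [K] stays in [L], as [psi]
   would otherwise jump from the base point; but then its limit points lie
   in both [I] and [L]. *)
Lemma exit_leaves x : L x -> exists2 t : R, 0 <= t & ~ K (phi t x).
Proof.
move=> Lx; apply: contrapT => /forall2NP xK.
have {}xK (t : R) : 0 <= t -> K (phi t x).
  by move=> t0; have [//|/contrapT] := xK t.
have xL (t : R) : 0 <= t -> L (phi t x).
  move=> t0; apply: contrapT => Lt.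
  have NLt : (N `\` L) (phi t x) by split => //; exact/KN/xK.
  (* Time runs backwards from [t]: [t - s] is the last time up to [t] at which the orbit lies in
     [L]. *)
  have [|||s [s0 st Ls sL]] := @first_hit _ [set u | L (phi (t - u) x)] t.
  - apply: (closed_comp (f := fun u => phi (t - u) x)) => // u _.
    by apply: (flow_cvg phi_flow); [apply: cvgB; [exact: cvg_cst|exact: cvg_id]|exact: cvg_cst].
  - by [].
  - by rewrite /= subrr flow0.
  have {}s0 : 0 < s.
    by rewrite lt_neqAle s0 andbT; apply/eqP => s0'; move: Ls; rewrite /= -s0' subr0.
  (* For [u] slightly below [s] the orbit from [phi (t - u) x] reaches [phi t x] without meeting
     [L]. Continuity of [psi] at [u = s] would make this constant value, not the base point,
     converge to the base point. *)
  have cnst : \forall u \near s^'-, psi u (proj (phi (t - u) x)) = proj (phi t x).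
    near=> u; have u0 : 0 <= u by apply: ltW; near: u; exact: nbhs_left_gt.
    have us : u < s by near: u; exact: nbhs_left_lt.
    rewrite semiflow_proj//; first by rewrite -flowD// addrC subrK.
    move=> v v0 vu; rewrite -flowD// (_ : v + (t - u) = t - (u - v)); last by ring.
    split; last first.
      by apply: sL; [rewrite subr_ge0|rewrite (le_lt_trans _ us)// gerBl].
    by apply/KN/xK; rewrite subr_ge0 (le_trans _ st)// (le_trans _ (ltW us))// gerBl.
  have cvgs : psi u (proj (phi (t - u) x)) @[u --> s^'-] --> psi s (proj (phi (t - s) x)).
    apply: (@semiflow_cvg _ _ _ _ _ psi_continuous _ _ _ id (fun u => proj (phi (t - u) x))).
    - exact: ltW.
    - apply: filterS (nbhs_left_gt s0) => u; exact: ltW.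
    - exact: cvg_within.
    - apply: (@cvg_comp_within _ _ _ _ _ (fun u => phi (t - u) x) proj N (phi (t - s) x)).
      + apply: cvg_within_filter.
        by apply: (flow_cvg phi_flow); [apply: cvgB; [exact: cvg_cst|exact: cvg_id]|exact: cvg_cst].
      + apply: filterS (nbhs_left_lt s) => u us.
        by apply/KN/xK; rewrite subr_ge0; exact: le_trans (ltW us) st.
      + apply: ((subspace_continuousP _ _).1 (@proj_continuous _ N L)).
        by apply/KN/xK; rewrite subr_ge0.
  have pN : proj (phi (t - s) x) = None by apply: proj_None => -[].
  rewrite pN in cvgs.
  have /cvgs : nbhs (psi s None) (~` [set proj (phi t x)]).
    apply: open_nbhs_nbhs; split; last exact/nesym/proj_neq_None.
    by apply: open_setC1_proj => //; exact: accessible_closed_set1 (hausdorff_accessible _) _.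
  move=> ne; have [u []] := @filter_ex _ _ (at_left_proper_filter s) _ (filterI cnst ne).
  by move=> + ue; exact: ue.
have [z Kz xz] := omega_nonempty cK xK.
apply: (@I_notin_L z); first exact: (omega_sub_invariant phi_flow K_isolating clK xK xz).
exact: omega_sub clL xL _ xz.
Unshelve. all: by end_near. Qed.

(** Each point of [L] is outside the closed set [K] at some time, and so are nearby points at that
    same time; compactness of [L] yields a common [T]. *)
Lemma base_point_absorbing : exists (T : R) (O : set (collapsed N L)),
  [/\ 0 <= T, open O, O None & forall y, O y -> psi T y = None].
Proof.
have exit x : L x -> exists2 t : R, 0 <= t &
    nbhs x [set x' | psi t (proj x') = None].
  move=> Lx; have [t t0 Kt] := exit_leaves Lx; exists t => //.
  have : nbhs x (phi t @^-1` (~` K)).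
    apply: (flow_continuous phi_flow); apply: open_nbhs_nbhs.
    by split => //; exact: closed_openC.
  apply: filterS => x' Kx'; apply: (@semiflow_exit _ _ _ _ _ t) => //.
  by move/subset_closure.
have semiflow_None_le (s t : R) y : 0 <= s -> s <= t -> psi s y = None -> psi t y = None.
  by move=> s0 st ys; rewrite -(subrK s t) semiflowD// ?subr_ge0// ys.
have near_L : \forall T \near +oo,
    L `<=` (fun x => nbhs x [set x' | psi T (proj x') = None]).
  apply: (compact_near_coveringP L).1 => // x /exit[t t0 xt].
  exists ((interior [set x' | psi t (proj x') = None]), [set T | t <= T]).
    split => /=; first exact: nbhs_interior.
    exact: nbhs_pinfty_ge (num_real t).
  move=> [x' T] [/= tx' tT]; apply: filterS tx' => z.
  exact: semiflow_None_le.
have [T [LT T0]] := @filter_ex _ _ proper_pinfty_nbhs _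
  (filterI near_L (nbhs_pinfty_ge (num_real 0))).
pose G := interior [set x' | psi T (proj x') = None].
have LG : L `<=` G by [].
have GT x : G x -> psi T (proj x) = None by move/interior_subset.
(* [None] is added by hand because [G] may be empty when [L] is. *)
exists T, ([set None] `|` proj @` G); split => //; last first.
- by move=> y [->//|[x /GT xT <-]].
- by left.
apply/open_collapsedP; exists G; first exact: open_interior.
move=> x Nx; split=> [[xN|[z Gz zx]]|Gx]; last by right; exists x.
- apply: LG; apply: contrapT => Lx.
  exact: proj_neq_None (conj Nx Lx) xN.
- have [Lx|Lx] := pselect (L x); first exact: LG.
  by rewrite (proj_inj (conj Nx Lx) (esym zx)).
Qed.

(** The second alternative asks for a limit point in [A], not for convergence to it: this is what
    [omega_rest_point] supplies. *)
Definition basin (A : set X) : set (collapsed N L) := [set y |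
  (exists2 t : R, 0 <= t & psi t y = None) \/
  (exists x, [/\ y = proj x, forall t : R, 0 <= t -> (N `\` L) (phi t x)
     & exists2 r, A r & omega phi x r])].

Lemma basin_sub A B : A `<=` B -> basin A `<=` basin B.
Proof.
move=> AB y [?|[x [yx xs [r Ar xr]]]]; first by left.
by right; exists x; split => //; exists r => //; exact: AB.
Qed.

Lemma basin_back A (t : R) y : 0 <= t -> basin A (psi t y) -> basin A y.
Proof.
move=> t0 [[s s0 yN]|[x [yx xs [r Ar xr]]]].
  by left; exists (s + t); [exact: addr_ge0|rewrite semiflowD].
case: (collapsedP y) => [->|[z NLz yz]]; first by left; exists 0.
have [zs|/existsNP[u /not_implyP[u0 NLu]]] :=
    pselect (forall u : R, 0 <= u -> (N `\` L) (phi u z)); last first.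
  by left; exists u => //; rewrite yz; exact: (semiflow_exit u0 _ NLu).
right; exists z; split => //; exists r => //.
move: yx; rewrite yz semiflow_proj//; last by move=> s s0 _; exact: zs.
by move=> /(proj_inj (zs _ t0)) zx; rewrite -(omega_shift phi_flow t) zx.
Qed.

(** * Basins of rest points ordered by the Lyapunov function *)

Section Gradient.
Context (g : X -> R).
Hypothesis g_continuous : {within I, continuous g}.
Hypothesis g_decreasing : forall x, I x -> ~ rest_points phi x ->
  forall s t : R, s < t -> g (phi t x) < g (phi s x).

Lemma basin_cover A y : I `&` rest_points phi `<=` A -> basin A y.
Proof.
move=> IA; case: (collapsedP y) => [->|[x NLx ->]]; first by left; exists 0.
have [xs|/existsNP[u /not_implyP[u0 NLu]]] :=
    pselect (forall u : R, 0 <= u -> (N `\` L) (phi u x)); last first.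
  by left; exists u => //; exact: (semiflow_exit u0 _ NLu).
have xK (t : R) : 0 <= t -> K (phi t x) by move=> /xs/subset_closure.
have [r [Ir rr xr]] := omega_rest_point phi_flow K_isolating clK g_continuous g_decreasing xK.
by right; exists x; split => //; exists r => //; exact: IA.
Qed.

(* An orbit that comes close to [r] and then leaves [B] has spent a long time
   in [B]; so its exit point is close to an orbit of [I] emanating from [r],
   whose limit points are rest points below [r]. *)
Lemma rest_point_nbhs A r U : I r -> rest_points phi r -> open (basin A) ->
  (forall r', I r' -> rest_points phi r' -> g r' < g r -> A r') ->
  finite_set (I `&` rest_points phi) -> open U -> U `<=` D -> U r ->
  exists2 B, nbhs r B & forall x, B x -> basin A (proj x) \/
    (forall t : R, 0 <= t -> U (phi t x)) /\ omega phi x r.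
Proof.
move=> Ir rr oA lowA finI oU UD Ur.
(* The other rest points of [I] form a finite, hence closed, set; keeping [closure B] away from it
   makes [r] the only rest point of [I] there. *)
pose F := (I `&` rest_points phi) `\` [set r].
have clF : closed F.
  apply: (accessible_finite_set_closed.1 (hausdorff_accessible X_hausdorff)).
  exact: finite_setD.
have UKr : nbhs r (U `&` ~` F).
  apply: open_nbhs_nbhs; split; first by apply: openI => //; exact: closed_openC.
  by split => // -[_ /(_ erefl)].
have [W rW WU] : exists2 W, nbhs r W & closure W `<=` U `&` ~` F.
  have NN : nbhs r N.
    apply: (@filterS _ _ _ D) => [x /index_interior_sub[]//|].
    apply: open_nbhs_nbhs; split; last exact: UD.
    exact: open_index_interior.
  by have [W rW WU] := compact_regular X_hausdorff cN NN UKr; exists W.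
pose B := interior W.
have oB : open B by exact: open_interior.
have Br : B r by [].
have clBU : closure B `<=` U `&` ~` F.
  by apply: subset_trans WU; apply: closure_subset; exact: interior_subset.
have clB_rest z : closure B z -> I z -> rest_points phi z -> z = r.
  move=> /clBU[_ Fz] Iz rz; apply: contrapT => zr; exact: Fz.
have BclB : B `<=` closure B by exact: subset_closure.
have clBNL : closure B `<=` N `\` L by move=> z /clBU[/UD/index_interior_sub].
have clBK z : closure B z -> K z by move=> /clBNL/subset_closure.
(* If the forward orbit stays in [N] minus [L], the full orbit of [z] lies in [K], so [z] is in [I].
   It has [r] as backward limit point and a rest point [p] as forward one, with [g p < g z < g r],
   so [p] is in [A]. *)
have back_basin z : (closure B `\` B) z ->
    (forall t : R, 0 <= t -> closure B (phi (- t) z)) -> basin A (proj z).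
  move=> [clBz Bz] zB.
  have [zs|/existsNP[u /not_implyP[u0 NLu]]] :=
      pselect (forall u : R, 0 <= u -> (N `\` L) (phi u z)); last first.
    by left; exists u => //; exact: (semiflow_exit u0 _ NLu).
  have zK (t : R) : 0 <= t -> K (phi t z) by move=> /zs/subset_closure.
  have zK' (t : R) : 0 <= t -> K (phi (- t) z) by move=> /zB/clBK.
  have Iz : I z.
    apply: (orbit_in_invariant phi_flow K_isolating) => t.
    have [|/ltW t0] := leP 0 t; first exact: zK.
    by rewrite -(opprK t); apply: zK'; rewrite oppr_ge0.
  have nrz : ~ rest_points phi z.
    by move=> rz; apply: Bz; rewrite (clB_rest z).
  have [p [Ip rp zp]] := omega_rest_point phi_flow K_isolating clK
    g_continuous g_decreasing zK.
  (* The backward limit point comes from the reversed flow, with [- g] as its Lyapunov function. *)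
  have rev_flow := flow_reverse phi_flow.
  have rev_rest x : rest_points (fun t => phi (- t)) x -> rest_points phi x.
    by move=> rx t; rewrite -[in LHS](opprK t); exact: rx.
  have rev_cont : {within I, continuous (fun x => - g x)}.
    by move=> x; apply: continuousN; exact: g_continuous.
  have rev_decr x : I x -> ~ rest_points (fun t => phi (- t)) x ->
      forall s t : R, s < t -> - g (phi (- t) x) < - g (phi (- s) x).
    move=> Ix nrx s t st; rewrite ltrN2; apply: g_decreasing => //.
      by move=> rx; apply: nrx => u; exact: rx.
    by rewrite ltrN2.
  have [q [Iq /rev_rest rq zq]] := omega_rest_point rev_flow
    (isolating_neighborhood_reverse phi_flow K_isolating) clK rev_cont rev_decr zK'.
  have qr : q = r.
    by apply: clB_rest => //; exact: (omega_sub (@closed_closure _ B) zB zq).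
  right; exists z; split => //; exists p => //; apply: lowA => //.
  have invI := index_pair_invariant.
  apply: (@lt_trans _ _ (g z)).
    exact: (lyapunov_omega_lt phi_flow invI g_continuous g_decreasing Iz nrz Ip zp).
  rewrite -ltrN2 -qr.
  apply: (lyapunov_omega_lt rev_flow _ rev_cont rev_decr Iz _ Iq zq).
    by move=> t; exact: invI.
  by move=> /rev_rest.
(* Each alternative persists on a neighbourhood, so compactness of the boundary gives one [T]
   bounding the backward escape times. *)
have near_T : \forall T \near +oo, closure B `\` B `<=`
    (fun z => basin A (proj z) \/
       exists t : R, [/\ 0 <= t, t <= T & ~ closure B (phi (- t) z)]).
  apply: (compact_near_coveringP (closure B `\` B)).1 => [|z zB].
    apply: (subclosed_compact _ cK); last by move=> z [/clBK].
    by rewrite setDE; apply: closedI; [exact: closed_closure|exact: open_closedC].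
  have [/(back_basin z zB) Az|] :=
      pselect (forall t : R, 0 <= t -> closure B (phi (- t) z)).
    have : nbhs z (proj @^-1` basin A).
      apply: (@proj_interior_continuous _ N L); last exact: open_nbhs_nbhs.
      apply: (@filterS _ _ _ D) => [x /index_interior_sub[]//|].
      apply: open_nbhs_nbhs; split; first exact: open_index_interior.
      by case: zB => /clBU[/UD].
    move=> nA; exists (proj @^-1` basin A, setT).
      by split => //=; exact: filterT.
    by move=> [z' T] [/= Az' _]; left.
  move=> /existsNP[t /not_implyP[t0 Bt]].
  exists (phi (- t) @^-1` (~` closure B), [set T | t <= T]).
    split => /=; last exact: nbhs_pinfty_ge (num_real t).
    apply: (flow_continuous phi_flow); apply: open_nbhs_nbhs.
    by split => //; apply: closed_openC; exact: closed_closure.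
  by move=> [z' T] [/= Bz' tT]; right; exists t.
have [T [exitT T0]] := @filter_ex _ _ proper_pinfty_nbhs _
  (filterI near_T (nbhs_pinfty_ge (num_real 0))).
(* As [r] is fixed, points close to it remain in [B] throughout [[0, T]]. *)
have nearB : \forall x \near r, `[0, T] `<=` (fun t => B (phi t x)).
  apply: (compact_near_coveringP `[0, T]).1 => [|t _].
    exact: segment_compact.
  have nB : nbhs (phi t r) B by rewrite rr; exact: open_nbhs_nbhs.
  by case: (phi_flow) => cphi _ _; exact: (cphi (t, r) _ nB).
exists [set x | `[0, T] `<=` (fun t => B (phi t x))] => // x xB.
have [xs|/existsNP[t /not_implyP[t0 Bt]]] :=
    pselect (forall t : R, 0 <= t -> B (phi t x)).
  right; split=> [t /xs/BclB/clBU[]//|].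
  have xK (t : R) : 0 <= t -> K (phi t x) by move=> /xs/BclB/clBK.
  have [p [Ip rp xp]] := omega_rest_point phi_flow K_isolating clK
    g_continuous g_decreasing xK.
  rewrite -(clB_rest p)//; apply: (omega_sub (@closed_closure _ B) _ xp (T := 0)).
  by move=> t /xs/BclB.
(* [s] is the first time outside the open set [B]; it exceeds [T], and [phi s x] is a boundary point
   of [B]. *)
left; have [||//|s [s0 st Bs sB]] := @first_hit _ [set u | ~ B (phi u x)] t.
- apply: (closed_comp (f := fun u => phi u x) (D := ~` B)) => [u _|].
    exact: (orbit_continuous phi_flow).
  exact: open_closedC.
- by [].
have {}sB (u : R) : 0 <= u -> u < s -> B (phi u x).
  by move=> u0 us; exact: contrapT (sB u u0 us).
have Ts : T < s.
  rewrite ltNge; apply/negP => sT; apply: Bs; apply: xB => /=.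
  by rewrite in_itv/= s0.
have clBs : closure B (phi s x).
  apply: (@closed_cvg _ _ s^'- _ (fun u => phi u x) (closure B)).
  - exact: closed_closure.
  - near=> u; apply: BclB; apply: sB.
      by apply: ltW; near: u; apply: nbhs_left_gt; exact: le_lt_trans Ts.
    by near: u; exact: nbhs_left_lt.
  - by apply: cvg_within_filter; exact: (orbit_continuous phi_flow).
have [//|As|[u [u0 uT Bu]]] := exitT (phi s x).
  apply: (@basin_back _ s) => //; rewrite semiflow_proj// => u u0.
  rewrite le_eqVlt => /predU1P[->|us]; first exact: clBNL.
  by apply: clBNL; apply: BclB; exact: sB.
(* The escape alternative fails: for [0 <= u <= T < s] the point [phi (s - u) x] is still in
   [closure B]. *)
exfalso; apply: Bu; rewrite -flowD//.
have [->|u0'] := eqVneq u 0; first by rewrite oppr0 add0r.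
apply: BclB; apply: sB.
  by rewrite addrC subr_ge0 (le_trans uT)// ltW.
by rewrite gtrDr oppr_lt0 lt_neqAle eq_sym u0'.
Unshelve. all: by end_near. Qed.

(** Supplies the local uniformity for compactness arguments. If [y] is not in the open basin of [A],
    its orbit enters at some time [t] the neighbourhood of [r] from [rest_point_nbhs], and
    continuity of [psi t] extends this to nearby points with the same [t]. *)
Lemma basin_add_nbhs A r U y : I r -> rest_points phi r -> open (basin A) ->
  (forall r', I r' -> rest_points phi r' -> g r' < g r -> A r') ->
  finite_set (I `&` rest_points phi) -> open U -> U `<=` D -> U r ->
  basin (r |` A) y ->
  exists2 t : R, 0 <= t & \forall y' \near y, basin A y' \/
    basin (r |` A) y' /\ forall s : R, t <= s -> (proj @` U) (psi s y').
Proof.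
move=> Ir rr oA lowA finI oU UD Ur yA.
have in_basin_A : basin A y -> exists2 t : R, 0 <= t &
    \forall y' \near y, basin A y' \/
      basin (r |` A) y' /\ forall s : R, t <= s -> (proj @` U) (psi s y').
  move=> Ay; exists 0 => //.
  have : nbhs y (basin A) by exact: open_nbhs_nbhs.
  by apply: filterS => y' Ay'; left.
case: yA => [yN|[x [yx xs [p [->|Ap] xp]]]]; first by apply: in_basin_A; left.
  have [B0 rB0 B0U] := rest_point_nbhs Ir rr oA lowA finI oU UD Ur.
  pose B := interior B0 `&` D.
  have oB : open B.
    by apply: openI; [exact: open_interior|exact: open_index_interior].
  have BNL : B `<=` N `\` L by move=> z [_ /index_interior_sub].
  have nB : nbhs r B.
    by apply: open_nbhs_nbhs; split => //; split; [exact: rB0|exact: UD].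
  have [t t0 Bt] := xp _ 0 nB.
  exists t => //.
  have : nbhs y (psi t @^-1` (proj @` B)).
    apply: (semiflow_continuous psi_continuous t0); apply: open_nbhs_nbhs.
    split; first exact: open_proj.
    by exists (phi t x) => //; rewrite yx semiflow_proj// => s s0 _; exact: xs.
  apply: filterS => y' [z Bz zy'].
  have [|Az|[zU zr]] := B0U z; first by apply: interior_subset; case: Bz.
    by left; apply: (basin_back t0); rewrite -zy'.
  have zNL (s : R) : 0 <= s -> (N `\` L) (phi s z).
    by move=> s0; exact/index_interior_sub/UD/zU.
  right; split.
    apply: (basin_back t0); rewrite -zy'; right; exists z; split => //.
    by exists r => //; left.
  move=> s ts; rewrite -(subrK t s) semiflowD ?subr_ge0// -zy'.
  rewrite semiflow_proj ?subr_ge0//; last by move=> u u0 _; exact: zNL.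
  by exists (phi (s - t) z) => //; apply: zU; rewrite subr_ge0.
by apply: in_basin_A; right; exists x; split => //; exists p.
Qed.

(** * Covering basins by contractible open sets *)

Definition contractibly_covered (n : nat) (S : set (collapsed N L)) :=
  exists U : nat -> set (collapsed N L),
    (forall i, (i < n)%N -> open (U i) /\ contractible_in R (U i) setT) /\
    S `<=` \bigcup_(i in `I_n) U i.

Lemma contractibly_coveredS n S O : open O -> contractible_in R O setT ->
  contractibly_covered n (S `\` O) -> contractibly_covered n.+1 S.
Proof.
(* Only indices below [n] are constrained in the given cover, so [O] can be placed at index [n]. *)
move=> oO cO [U [Uo SU]]; exists (fun i => if i == n then O else U i); split.
  move=> i; rewrite ltnS leq_eqVlt; case: eqP => //= _; exact: Uo.
move=> y Sy; have [Oy|Oy] := pselect (O y).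
  by exists n => /=; rewrite ?eqxx.
have [i /= lin Ui] := SU y (conj Sy Oy); exists i => /=; first exact: ltnW.
by rewrite ltn_eqF.
Qed.

Lemma basin_set0_covered : open (basin set0) /\
  forall S, compact S -> S `<=` basin set0 -> contractibly_covered 1 S.
Proof.
have [T [ O [T0 oO ON OT]]] := base_point_absorbing.
have back y : basin set0 y -> exists2 t : R, 0 <= t & nbhs y (psi t @^-1` O).
  move=> [[t t0 yN]|[x [_ _ [r []]]]]; exists t => //.
  apply: (semiflow_continuous psi_continuous t0); apply: open_nbhs_nbhs.
  by rewrite yN.
split.
  rewrite openE => y /back[t t0]; apply: filterS => y' /OT y'N.
  by left; exists (T + t); [exact: addr_ge0|rewrite semiflowD].
move=> S cS Sb.
have near_T : \forall T' \near +oo, S `<=` (fun y => psi T' y = None).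
  apply: (compact_near_coveringP S).1 => // y /Sb/back[t t0 yt].
  exists (psi t @^-1` O, [set T' | T + t <= T']).
    by split => //=; exact: nbhs_pinfty_ge (num_real _).
  move=> [y' T'] [/= /OT y'N tT'].
  rewrite -(subrK (T + t) T') semiflowD ?subr_ge0 ?addr_ge0//.
  rewrite (semiflowD phi_flow _ T0 t0).
  exact: (congr1 (psi (T' - (T + t))) y'N).
have [T' [ST' T'0]] := @filter_ex _ _ proper_pinfty_nbhs _
  (filterI near_T (nbhs_pinfty_ge (num_real 0))).
(* [S] is at the base point by time [T'], but the preimage of the base point alone need not be open.
   The preimage of [O] is, and a further time [T] sends it to the base point. *)
apply: (@contractibly_coveredS _ _ (psi T' @^-1` O)).
- by apply: open_comp => // y _; exact: semiflow_continuous.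
- apply: (contractible_in_pullback phi_flow psi_continuous T'0 (B := O)) => //.
  apply: (contractible_in_pullback phi_flow psi_continuous T0 (B := [set None])) => //.
  exact: contractible_in_set1.
- exists (fun=> set0); split => // y [Sy]; case.
  by rewrite /preimage/= ST'.
Qed.

Lemma basin_covered_step n A r : semi_locally_contractible R X ->
  I r -> rest_points phi r -> finite_set (I `&` rest_points phi) ->
  (forall r', I r' -> rest_points phi r' -> g r' < g r -> A r') ->
  (open (basin A) /\
    forall S, compact S -> S `<=` basin A -> contractibly_covered n S) ->
  open (basin (r |` A)) /\
    forall S, compact S -> S `<=` basin (r |` A) -> contractibly_covered n.+1 S.
Proof.
move=> X_slc Ir rr finI lowA [oA covA].
have oD := open_index_interior; have DNL := index_interior_sub.
have Dr : D r by exact: invariant_sub_index_interior.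
split.
  (* For openness any admissible neighbourhood of [r] will do, so [U] is all of [D]. *)
  rewrite openE => y yA.
  have [t t0] := basin_add_nbhs Ir rr oA lowA finI oD (@subset_refl _ D) Dr yA.
  by apply: filterS => y' [Ay'|[//]]; apply: (basin_sub _ Ay') => x; right.
move=> S cS SA.
have [V0 [rV0 V0D cV0]] := X_slc r D oD Dr.
pose V := interior V0.
have oV : open V by exact: open_interior.
have VD : V `<=` D by exact: subset_trans (@interior_subset _ _) V0D.
have cV : contractible_in R (proj @` V) setT.
  apply: (contractible_in_proj clL oV VD oD DNL).
  by apply: contractible_in_sub cV0; exact: interior_subset.
(* The times from [basin_add_nbhs] may be replaced by any later ones, so compactness yields a common
   [T]. *)
have near_T : \forall T \near +oo, S `\` basin A `<=`
    (fun y => basin A y \/ (proj @` V) (psi T y)).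
  apply: (compact_near_coveringP (S `\` basin A)).1 => [|y [/SA yA _]].
    by rewrite setDE; apply: compact_closedI => //; exact: open_closedC.
  have [t t0 yt] := basin_add_nbhs Ir rr oA lowA finI oV VD rV0 yA.
  exists ([set y' | basin A y' \/ basin (r |` A) y' /\
      forall s : R, t <= s -> (proj @` V) (psi s y')], [set T | t <= T]).
    by split => //=; exact: nbhs_pinfty_ge (num_real _).
  by move=> [y' T] /= [[|[_ Vs]] tT]; [left|right; exact: Vs].
have [T [ST T0]] := @filter_ex _ _ proper_pinfty_nbhs _
  (filterI near_T (nbhs_pinfty_ge (num_real 0))).
have oVT : open (psi T @^-1` (proj @` V)).
  apply: open_comp => [y _|]; first exact: semiflow_continuous.
  by apply: open_proj => //; exact: subset_trans VD DNL.
apply: (contractibly_coveredS oVT).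
  exact: (contractible_in_pullback phi_flow psi_continuous T0 (B := proj @` V)).
apply: covA.
  by rewrite setDE; apply: compact_closedI => //; exact: open_closedC.
move=> y [Sy VTy]; apply: contrapT => Ay.
by have [] := ST y (conj Sy Ay).
Qed.

(** Induction on [s], whose head has the largest value of [g]. The last hypothesis makes [s] closed
    under passing to rest points of strictly smaller value; it passes to the tail, and ties may come
    in any order. *)
Lemma basin_seq_covered (s : seq X) : semi_locally_contractible R X ->
  finite_set (I `&` rest_points phi) ->
  (forall r, r \in s -> I r /\ rest_points phi r) ->
  sorted (fun x y => g y <= g x) s ->
  (forall r r', r \in s -> I r' -> rest_points phi r' -> g r' < g r -> r' \in s) ->
  open (basin [set` s]) /\ forall S, compact S -> S `<=` basin [set` s] ->
    contractibly_covered (size s).+1 S.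
Proof.
move=> X_slc finI; elim: s => [|r s IHs] sI.
  by move=> _ _; rewrite set_nil; exact: basin_set0_covered.
rewrite /= path_sortedE; last by move=> x y z xy yz; exact: le_trans yz xy.
move=> /andP[/allP rs ss] low.
have [Ir rr] : I r /\ rest_points phi r by apply: sI; rewrite mem_head.
(* A rest point strictly below [x], with [g x <= g r], differs from [r] and so lies in the tail. *)
have low_s x r' : g x <= g r -> I r' -> rest_points phi r' -> g r' < g x ->
    r' \in s.
  move=> xr Ir' rr' r'x; have r'r := lt_le_trans r'x xr.
  have := low r r' (mem_head _ _) Ir' rr' r'r.
  by rewrite inE => /predU1P[r'E|//]; move: r'r; rewrite r'E ltxx.
have -> : [set` r :: s] = r |` [set` s].
  apply/seteqP; split=> x /=; rewrite inE; first by move=> /predU1P[->|]; [left|right].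
  by move=> [->|->]; rewrite ?eqxx ?orbT.
apply: basin_covered_step => //.
  by move=> r' Ir' rr' r'r; exact: (low_s r).
apply: IHs => //.
  by move=> x xs; apply: sI; rewrite inE xs orbT.
by move=> x r' xs Ir' rr'; apply: low_s => //; exact: rs.
Qed.

End Gradient.
End IndexPair.

(** * The bound on the number of rest points *)

Lemma nuH_le (R : realType) (M : topologicalType) (n : nat) (A : set M)
    (U : nat -> set M) :
  (forall i, (i < n)%N -> open (U i) /\ contractible_in R (U i) setT) ->
  A `<=` \bigcup_(i in `I_n) U i -> (nuH R A <= n%:R%:E)%E.
Proof.
move=> Uo AU; apply: ereal_inf_lbound; exists n => //=.
exists (fun i : 'I_n => U i); split; first by move=> i; exact: Uo.
by move=> x /AU[i /= lin Ux]; exists (Ordinal lin).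
Qed.

Theorem theorem4p6 (R : realType) (X : metricType R)
    (X_slc : semi_locally_contractible R X)
    (phi : R -> X -> X) (phi_flow : is_flow phi)
    (I : set X) (I_isolated : isolated_invariant_set phi I)
    (I_gradient : gradient_like_on phi I)
    (N L : set X) (NL_index : index_pair phi N L I) :
  (nuH R [set: collapsed N L] - 1 <= counting (I `&` rest_points phi))%E.
Proof.
have [g g_continuous g_decreasing] := I_gradient.
(* With infinitely many rest points the count is [+oo] and the bound is immediate. *)
rewrite /counting; case: asboolP => [finI|_]; last exact: leey.
set rests := fset_set _.
pose s := sort (fun x y => g y <= g x) (finmap.enum_fset rests).
have sE x : x \in s <-> I x /\ rest_points phi x.
  by rewrite mem_sort in_fset_set// inE.
have sS : sorted (fun x y => g y <= g x) s.
  by apply: sort_sorted => x y; exact: le_total.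
have X_hausdorff := @metric_hausdorff _ X.
have [||_ cov] := @basin_seq_covered _ _ _ _ _ _ X_hausdorff phi_flow NL_index
  _ g_continuous g_decreasing s X_slc finI _ sS.
- by move=> r /sE.
- by move=> r r' _ Ir' rr' _; exact/sE.
have [|y _|U [Uo NLU]] := cov setT.
- by apply: compact_collapsed; case: NL_index.
- apply: (basin_cover phi_flow NL_index g_continuous g_decreasing).
  by move=> x ?; exact/sE.
(* The cover has one set more than there are rest points, namely the one for the base point. *)
rewrite leeBlDr//; apply: (le_trans (nuH_le Uo NLU)).
by rewrite size_sort -EFinD lee_fin natr1.
Qed.
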